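(* Let $R$ be an associative ring with identity of finite left global dimension, $1\ne x\in Z(R)$ a regular central element, $S=R/(x)$, and let $N$ be a left $S$-module of type $\mathrm{FP}_\infty$ over $S$. Let $P_\bullet=(P_j,d_j)\to N$ be a finite type $R$-projective resolution of length $n=\operatorname{pd}_R(N)<\infty$. Let $\overline P_\bullet$, $\Psi$, $\psi^{i}$, $\nu^i$, $\eta^i$ and $M^i_\bullet=(M^i_j,\partial^i_j)$ be as in the context (in particular, the lifts $\psi^{i+1}$ exist for all $i\ge 1$). Then the following hold. (1) For $i>0$ the complex $M^i_\bullet$ is a complex of finitely generated projective $S$-modules, given recursively by $$M^{i}_{j}=\begin{cases} M^{i-1}_{j} & 0\le j\le 2i-1,\\ \overline P_{j-2i}\oplus M^{i-1}_{j} & 2i\le j\le 2i+n-2,\\ \overline P_{j-2i} & j=2i+n-1,\ 2i+n,\end{cases}$$ $$\partial^{i}_{j}=\begin{cases}\partial^{i-1}_{j} & 1\le j\le 2i-1,\\ \begin{bmatrix}-\psi^{i}_{1}\\ \partial^{i-1}_{2i}\end{bmatrix} & j=2i,\\ \begin{bmatrix}\overline d_{j-2i} & -\psi^{i}_{j-(2i-1)}\\ 0 & \partial^{i-1}_{j}\end{bmatrix} & 2i+1\le j\le 2i+n-2,\\ \begin{bmatrix}\overline d_{n-1} & -\psi^{i}_{n}\end{bmatrix} & j=2i+n-1,\\ \overline d_{n} & j=2i+n.\end{cases}$$ (2) For $i>0$, $H_j(M^i_\bullet)\cong N$ for $j=0$ and $j=2i+1$, and $H_j(M^i_\bullet)=0$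 otherwise. (3) For $i>0$ the map $\psi^{i+1}:\Sigma^{2i+1}\overline P_\bullet\to M^i_\bullet$ induces an isomorphism $\psi^{i+1}_*:H_{2i+1}(\Sigma^{2i+1}\overline P_\bullet)\to H_{2i+1}(M^i_\bullet)$. (4) The direct limit $M_\bullet=\varinjlim_i M^i_\bullet$ along the maps $\eta^i$ is a finite type projective resolution of the $S$-module $N$.
   Context: All modules are left modules; maps are written on the right of their arguments, matrices act on the right of row vectors, and composition is left to right. A module is of type $\mathrm{FP}_\infty$ if it has a resolution by finitely generated projectives; a resolution is finite type if each term is finitely generated. The suspension is $(\Sigma C)_j=C_{j-1}$, $\partial^{\Sigma C}_j=-\partial^C_{j-1}$. The mapping cone of a chain map $f:A_\bullet\to B_\bullet$ is $\operatorname{Con}(f)_i=A_{i-1}\oplus B_i$ with differential $\begin{bmatrix}-d^A_{i-1}&-f_{i-1}\\0&d^B_i\end{bmatrix}$; there is a short exact sequence $0\to B_\bullet\to\operatorname{Con}(f)\to\Sigma A_\bullet\to0$. Construction. Let $\overline P_\bullet=P_\bullet\otimes_R S$ (i.e. $P_\bullet/xP_\bullet$), with differential $\overline d$. Multiplication by $x$ on $P_\bullet$ is null-homotopic; choose a null-homotopy $\{\varphi_i:P_{i-1}\to P_i\}_{i\ge1}$, so $d_i\varphi_i+\varphi_{i+1}d_{i+1}=x\cdot$ on $P_i$. The reductions $\overline\varphi_i:\overline P_{i-1}\to\overline P_i$ form a chain map $\Psi:\Sigma\overline P_\bullet\to\overline P_\bullet$ that induces an isomorphism on $H_1$. Set $M^0_\bullet=\overline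 P_\bullet$, $\psi^1=\Psi$, $M^1_\bullet=\operatorname{Con}(\psi^1)$. Inductively, for $i\ge1$, with $M^i_\bullet=\operatorname{Con}(\psi^i)$, where $\psi^i:\Sigma^{2i-1}\overline P_\bullet\to M^{i-1}_\bullet$, let $\eta^{i-1}:M^{i-1}_\bullet\to M^i_\bullet$ and $\nu^i:M^i_\bullet\to\Sigma^{2i}\overline P_\bullet$ be the inclusion and projection of the mapping cone sequence, choose a chain map $\psi^{i+1}:\Sigma^{2i+1}\overline P_\bullet\to M^i_\bullet$ with $\psi^{i+1}\nu^i=\Sigma^{2i}\Psi$, and put $M^{i+1}_\bullet=\operatorname{Con}(\psi^{i+1})$. Indexing: the component of $\psi^i$ in degree $2i-2+m$ is denoted $\psi^i_m:\overline P_{m-1}\to M^{i-1}_{2i-2+m}$ for $m\ge1$. Modules outside the listed ranges are zero, and matrix blocks with zero source or target are omitted. *)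

(* Defs.v *)
From HB Require Import structures.
From mathcomp Require Import all_boot all_algebra.
From mathcomp Require Import boolp.
Import GRing.Theory.

Set Implicit Arguments.
Unset Strict Implicit.
Unset Printing Implicit Defensive.

Local Open Scope ring_scope.
Local Open Scope quotient_scope.

(* Rings are [pzRingType]s, so the zero ring is not excluded: R/(x) is the zero
   ring when x is a unit. *)

(* ** Submodules and quotient modules *)

Record submodule (R : pzRingType) (V : lmodType R) := Submodule {
  in_submodule :> V -> Prop;
  submodule0 : in_submodule 0;
  submoduleP : forall (a : R) (u v : V),
    in_submodule u -> in_submodule v -> in_submodule (a *: u + v) }.

Section SubQuotient.
Variables (R : pzRingType) (V : lmodType R) (U : submodule V).

Definition submodule_pred : {pred V} := fun u => `[< U u >].

Lemma submodule_predE u : (u \in submodule_pred) = `[< U u >].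
Proof. by []. Qed.

Lemma submodule_pred_closed : submod_closed submodule_pred.
Proof.
split=> [|a u v]; rewrite !submodule_predE; first exact/asboolP/submodule0.
by move=> /asboolP uU /asboolP vU; apply/asboolP/submoduleP.
Qed.

HB.instance Definition _ :=
  GRing.isSubmodClosed.Build R V submodule_pred submodule_pred_closed.
HB.instance Definition _ := GRing.isZmodClosed.Build V submodule_pred
  (GRing.submod_closedB submodule_pred_closed).

Definition submod : Type := {u : V | u \in submodule_pred}.
HB.instance Definition _ := SubChoice.on submod.
HB.instance Definition _ := [SubChoice_isSubLmodule of submod by <:].

Definition quomod : Type := Quotient.quot submodule_pred.
HB.instance Definition _ := EqQuotient.on quomod.
HB.instance Definition _ := GRing.Zmodule.on quomod.

Definition quo (u : V) : quomod := \pi_(Quotient.quot submodule_pred) u.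

Lemma quoP u v : quo u = quo v <-> U (u - v).
Proof.
split=> [/eqP|uv].
  by rewrite -Quotient.idealrBE submodule_predE => /asboolP.
by apply/eqP; rewrite -Quotient.idealrBE submodule_predE; apply/asboolP.
Qed.

Lemma quo_repr (q : quomod) : quo (repr q) = q.
Proof. exact: reprK. Qed.

Lemma quoD u v : quo (u + v) = quo u + quo v.
Proof. by rewrite /quo !piE. Qed.

Lemma submoduleZ a u : U u -> U (a *: u).
Proof. by move=> uU; rewrite -[_ *: _]addr0; apply/submoduleP/submodule0. Qed.

Definition quomod_scale (a : R) (q : quomod) : quomod := quo (a *: repr q).

Lemma quomod_scaleE a u : quomod_scale a (quo u) = quo (a *: u).
Proof. by apply/quoP; rewrite -scalerBr; apply/submoduleZ/quoP/quo_repr. Qed.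

Lemma quomod_scaleA a b q :
  quomod_scale a (quomod_scale b q) = quomod_scale (a * b) q.
Proof. by rewrite -(quo_repr q) !quomod_scaleE scalerA. Qed.

Lemma quomod_scale1 : left_id 1 quomod_scale.
Proof. by move=> q; rewrite -(quo_repr q) quomod_scaleE scale1r. Qed.

Lemma quomod_scaleDr : right_distributive quomod_scale +%R.
Proof.
move=> a p q; rewrite -(quo_repr p) -(quo_repr q).
by rewrite -quoD !quomod_scaleE -quoD scalerDr.
Qed.

Lemma quomod_scaleDl q : {morph quomod_scale^~ q : a b / a + b}.
Proof.
by move=> a b; rewrite -(quo_repr q) !quomod_scaleE -quoD scalerDl.
Qed.

HB.instance Definition _ := GRing.Zmodule_isLmodule.Build R quomod
  quomod_scaleA quomod_scale1 quomod_scaleDr quomod_scaleDl.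

Lemma quo_is_linear : linear quo.
Proof. by move=> a u v; rewrite quoD -quomod_scaleE. Qed.
HB.instance Definition _ := GRing.isLinear.Build R V quomod *:%R quo
  quo_is_linear.

End SubQuotient.

Section QuotientMap.
Variables (R : pzRingType) (V W : lmodType R).
Variables (U : submodule V) (X : submodule W) (f : {linear V -> W}).

Definition quomap (_ : forall u, U u -> X (f u)) (q : quomod U) : quomod X :=
  quo X (f (repr q)).

Hypothesis UX : forall u, U u -> X (f u).

Lemma quomapE u : quomap UX (quo U u) = quo X (f u).
Proof. by apply/quoP; rewrite -linearB; apply/UX/quoP/quo_repr. Qed.

Lemma quomap_is_linear : linear (quomap UX).
Proof.
move=> a p q; rewrite -(quo_repr p) -(quo_repr q) -linearP.
by rewrite !quomapE !linearP.
Qed.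
HB.instance Definition _ := GRing.isLinear.Build R (quomod U) (quomod X) *:%R
  (quomap UX) quomap_is_linear.

End QuotientMap.

(* ** The ring R/(x) for a central element x *)

Definition central (R : pzRingType) (x : R) := forall r : R, GRing.comm x r.

Section CentralQuotient.
Variables (R : pzRingType) (x : R) (xC : central x).

(* The submodule xV; it depends on the centrality of x. *)
Section Multiples.
Variable V : lmodType R.

Definition multiple (v : V) := exists w, v = x *: w.

Lemma multiple0 : multiple 0.
Proof. by exists 0; rewrite scaler0. Qed.

Lemma multipleP (a : R) (u v : V) :
  multiple u -> multiple v -> multiple (a *: u + v).
Proof.
move=> [u' ->] [v' ->]; exists (a *: u' + v').
by rewrite scalerDr !scalerA xC.
Qed.

Definition multiples : submodule V := Submodule multiple0 multipleP.

End Multiples.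

(* As x is central, the two-sided ideal (x) is the left submodule xR of R. *)
Definition quoring : Type := quomod (multiples R^o).
HB.instance Definition _ := GRing.Zmodule.on quoring.

Definition qr (r : R) : quoring := quo (multiples R^o) r.

Lemma qrP r s : qr r = qr s <-> exists t, r - s = x * t.
Proof. exact: quoP. Qed.

Lemma qr_repr (s : quoring) : qr (repr (s : quomod _)) = s.
Proof. exact: quo_repr. Qed.

Lemma qrD r s : qr (r + s) = qr r + qr s.
Proof. exact: quoD. Qed.

Definition quoring_mul (s t : quoring) : quoring :=
  qr ((repr (s : quomod _) : R) * (repr (t : quomod _) : R)).

Lemma quoring_mulE r s : quoring_mul (qr r) (qr s) = qr (r * s).
Proof.
apply/qrP; have /qrP[a ra] := qr_repr (qr r).
have /qrP[b sb] := qr_repr (qr s).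
rewrite (canRL (subrK _) ra) (canRL (subrK _) sb).
exists (a * (x * b + s) + r * b).
rewrite mulrDl [r * (_ + _)]mulrDr [r * (x * b)]mulrA -[r * x]xC.
by rewrite addrA addrK !mulrDr !mulrA.
Qed.

Lemma quoring_mulA : associative quoring_mul.
Proof.
move=> p q r; rewrite -(qr_repr p) -(qr_repr q) -(qr_repr r).
by rewrite !quoring_mulE mulrA.
Qed.

Lemma quoring_mul1 : left_id (qr 1) quoring_mul.
Proof. by move=> p; rewrite -(qr_repr p) quoring_mulE mul1r. Qed.

Lemma quoring_1mul : right_id (qr 1) quoring_mul.
Proof. by move=> p; rewrite -(qr_repr p) quoring_mulE mulr1. Qed.

Lemma quoring_mulDl : left_distributive quoring_mul +%R.
Proof.
move=> p q r; rewrite -(qr_repr p) -(qr_repr q) -(qr_repr r).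
by rewrite -qrD !quoring_mulE -qrD mulrDl.
Qed.

Lemma quoring_mulDr : right_distributive quoring_mul +%R.
Proof.
move=> p q r; rewrite -(qr_repr p) -(qr_repr q) -(qr_repr r).
by rewrite -qrD !quoring_mulE -qrD mulrDr.
Qed.

HB.instance Definition _ := GRing.Zmodule_isPzRing.Build quoring
  quoring_mulA quoring_mul1 quoring_1mul quoring_mulDl quoring_mulDr.

Lemma qr_is_zmod_morphism : zmod_morphism qr.
Proof. exact: raddfB. Qed.
HB.instance Definition _ :=
  GRing.isZmodMorphism.Build R quoring qr qr_is_zmod_morphism.

Lemma qr_is_monoid_morphism : monoid_morphism qr.
Proof. by split=> // r s; rewrite -quoring_mulE. Qed.
HB.instance Definition _ :=
  GRing.isMonoidMorphism.Build R quoring qr qr_is_monoid_morphism.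

(* V/xV as an R/(x)-module. *)
Section Reduction.
Variable V : lmodType R.

Definition red : Type := quomod (multiples V).
HB.instance Definition _ := GRing.Zmodule.on red.

Definition to_red (v : V) : red := quo (multiples V) v.

Lemma to_redP u v : to_red u = to_red v <-> exists w, u - v = x *: w.
Proof. exact: quoP. Qed.

Lemma to_red_repr (q : red) : to_red (repr (q : quomod _)) = q.
Proof. exact: quo_repr. Qed.

Lemma to_redD u v : to_red (u + v) = to_red u + to_red v.
Proof. exact: quoD. Qed.

Lemma to_red_eq0 v : to_red v = 0 <-> exists w, v = x *: w.
Proof.
have -> : (0 : red) = to_red 0 by rewrite /to_red linear0.
by rewrite to_redP subr0.
Qed.

Definition red_scale (s : quoring) (q : red) : red :=
  to_red ((repr (s : quomod _) : R) *: (repr (q : quomod _) : V)).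

Lemma red_scaleE r v : red_scale (qr r) (to_red v) = to_red (r *: v).
Proof.
apply/to_redP; have /qrP[a ra] := qr_repr (qr r).
have /to_redP[b vb] := to_red_repr (to_red v).
rewrite (canRL (subrK _) ra) (canRL (subrK _) vb).
exists (a *: (x *: b + v) + r *: b).
rewrite scalerDl [r *: (_ + _)]scalerDr [r *: (x *: b)]scalerA -[r * x]xC.
by rewrite -!scalerA addrA addrK !scalerDr !scalerA.
Qed.

Lemma red_scaleA s t q : red_scale s (red_scale t q) = red_scale (s * t) q.
Proof.
rewrite -(qr_repr s) -(qr_repr t) -(to_red_repr q) -rmorphM.
by rewrite !red_scaleE scalerA.
Qed.

Lemma red_scale1 : left_id 1 red_scale.
Proof.
by move=> q; rewrite -(to_red_repr q) -(rmorph1 qr) red_scaleE scale1r.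
Qed.

Lemma red_scaleDr : right_distributive red_scale +%R.
Proof.
move=> s p q; rewrite -(qr_repr s) -(to_red_repr p) -(to_red_repr q).
by rewrite -to_redD !red_scaleE -to_redD scalerDr.
Qed.

Lemma red_scaleDl q : {morph red_scale^~ q : s t / s + t}.
Proof.
move=> s t; rewrite -(qr_repr s) -(qr_repr t) -(to_red_repr q) -qrD.
by rewrite !red_scaleE -to_redD scalerDl.
Qed.

HB.instance Definition _ := GRing.Zmodule_isLmodule.Build quoring red
  red_scaleA red_scale1 red_scaleDr red_scaleDl.

Lemma to_redZ r v : to_red (r *: v) = qr r *: to_red v.
Proof. by rewrite -red_scaleE. Qed.

End Reduction.

Section ReductionMap.
Variables (V W : lmodType R) (f : {linear V -> W}).

Definition red_map (q : red V) : red W := to_red (f (repr (q : quomod _))).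

Lemma red_mapE v : red_map (to_red v) = to_red (f v).
Proof.
apply/to_redP; have /to_redP[b vb] := to_red_repr (to_red v).
by exists (f b); rewrite -linearB vb linearZ.
Qed.

Lemma red_map_is_linear : linear red_map.
Proof.
move=> s p q; rewrite -(qr_repr s) -(to_red_repr p) -(to_red_repr q).
by rewrite -to_redZ -to_redD !red_mapE linearP to_redD to_redZ.
Qed.
HB.instance Definition _ := GRing.isLinear.Build quoring (red V) (red W) *:%R
  red_map red_map_is_linear.

End ReductionMap.

(* An R/(x)-module viewed as an R-module. *)
Section Restriction.
Variable N : lmodType quoring.

Definition restr : Type := N.
HB.instance Definition _ := GRing.Zmodule.on restr.

Definition restr_scale (r : R) (u : restr) : restr := qr r *: (u : N).

Lemma restr_scaleA r s u :
  restr_scale r (restr_scale s u) = restr_scale (r * s) u.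
Proof. by rewrite /restr_scale scalerA rmorphM. Qed.

Lemma restr_scale1 : left_id 1 restr_scale.
Proof. by move=> u; rewrite /restr_scale rmorph1 scale1r. Qed.

Lemma restr_scaleDr : right_distributive restr_scale +%R.
Proof. by move=> r u v; rewrite /restr_scale scalerDr. Qed.

Lemma restr_scaleDl u : {morph restr_scale^~ u : r s / r + s}.
Proof. by move=> r s; rewrite /restr_scale rmorphD scalerDl. Qed.

HB.instance Definition _ := GRing.Zmodule_isLmodule.Build R restr
  restr_scaleA restr_scale1 restr_scaleDr restr_scaleDl.

End Restriction.
End CentralQuotient.

Arguments red_map {R x} xC {V W} f q.

(* ** Complexes, indexed by the natural numbers and zero in negative degrees *)

Record complex (R : pzRingType) := Complex {
  term :> nat -> lmodType R;
  diff : forall j, {linear term j.+1 -> term j};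
  diffK : forall j (u : term j.+2), diff j (diff j.+1 u) = 0 }.

Record chain_map (R : pzRingType) (C D : complex R) := ChainMap {
  cmap :> forall j, {linear C j -> D j};
  cmapP : forall j (u : C j.+1), cmap j (diff C j u) = diff D j (cmap j.+1 u) }.

Definition is_zero (R : pzRingType) (V : lmodType R) := forall u : V, u = 0.

Definition isomorphic (R : pzRingType) (V W : lmodType R) :=
  exists f : {linear V -> W}, bijective f.

Section Homology.
Variable R : pzRingType.

Section OneComplex.
Variables (C : complex R) (j : nat).

Definition is_cycle : C j -> Prop :=
  match j return C j -> Prop with
  | 0 => fun=> True
  | k.+1 => fun u => diff C k u = 0
  end.

Lemma is_cycle0 : is_cycle 0.
Proof. by rewrite /is_cycle; case: (j) => // k; rewrite linear0. Qed.

Lemma is_cycleP (a : R) (u v : C j) :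
  is_cycle u -> is_cycle v -> is_cycle (a *: u + v).
Proof.
rewrite /is_cycle; case: (j) u v => // k u v u0 v0.
by rewrite linearP u0 v0 scaler0 addr0.
Qed.

Definition cycles : submodule (C j) := Submodule is_cycle0 is_cycleP.

Definition is_boundary (z : submod cycles) := exists v, val z = diff C j v.

Lemma is_boundary0 : is_boundary 0.
Proof. by exists 0; rewrite linear0. Qed.

Lemma is_boundaryP (a : R) (y z : submod cycles) :
  is_boundary y -> is_boundary z -> is_boundary (a *: y + z).
Proof.
move=> [u yu] [v zv]; exists (a *: u + v).
by rewrite linearP -yu -zv.
Qed.

Definition boundaries : submodule (submod cycles) :=
  Submodule is_boundary0 is_boundaryP.

Definition homology : lmodType R := quomod boundaries.

End OneComplex.

Section HomologyMap.
Variables (C D : complex R) (f : chain_map C D) (j : nat).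

Lemma cycles_map (z : submod (cycles C j)) :
  f j (val z) \in submodule_pred (cycles D j).
Proof.
have /asboolP := valP z; move: (val z) => u uC.
rewrite submodule_predE; apply/asboolP; move: u uC.
rewrite /= /is_cycle; case: (j) => //= k u u0.
by rewrite -cmapP u0 linear0.
Qed.

Definition cycle_map (z : submod (cycles C j)) : submod (cycles D j) :=
  Sub (f j (val z)) (cycles_map z).

Lemma cycle_map_is_linear : linear cycle_map.
Proof. by move=> a y z; apply/val_inj; rewrite /= !linearP. Qed.
HB.instance Definition _ := GRing.isLinear.Build R
  (submod (cycles C j)) (submod (cycles D j)) *:%R
  cycle_map cycle_map_is_linear.

Lemma boundary_map z : boundaries C j z -> boundaries D j (cycle_map z).
Proof. by move=> [v zv]; exists (f j.+1 v); rewrite /= zv cmapP. Qed.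

Definition homology_map : {linear homology C j -> homology D j} :=
  quomap boundary_map.

End HomologyMap.
End Homology.

(* ** Projectives, resolutions, projective dimension *)

Section Resolutions.
Variable R : pzRingType.

Definition fin_gen (V : lmodType R) :=
  exists (k : nat) (g : 'I_k -> V), forall v : V,
    exists c : 'I_k -> R, v = \sum_(i < k) c i *: g i.

Definition projective (V : lmodType R) :=
  forall (A B : lmodType R) (g : {linear A -> B}) (f : {linear V -> B}),
    (forall b, exists a, g a = b) ->
    exists h : {linear V -> A}, forall v, g (h v) = f v.

Definition resolution (N : lmodType R) (C : complex R) (e : {linear C 0%N -> N}) :=
  [/\ forall y, exists u, e u = y,
      forall u : C 0%N, e u = 0 <-> exists v, u = diff C 0 v &
      forall j (u : C j.+1), diff C j u = 0 <-> exists v, u = diff C j.+1 v].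

Definition proj_resolution (N : lmodType R) (C : complex R)
    (e : {linear C 0%N -> N}) :=
  resolution e /\ forall j, projective (C j).

Definition fin_type_proj_resolution (N : lmodType R) (C : complex R)
    (e : {linear C 0%N -> N}) :=
  proj_resolution e /\ forall j, fin_gen (C j).

Definition FP_infty (N : lmodType R) :=
  exists (C : complex R) (e : {linear C 0%N -> N}), fin_type_proj_resolution e.

Definition length_le (C : complex R) (n : nat) :=
  forall j, (n < j)%N -> is_zero (C j).

Definition pd_le (N : lmodType R) (n : nat) :=
  exists (C : complex R) (e : {linear C 0%N -> N}),
    proj_resolution e /\ length_le C n.

(* With this convention the zero module has projective dimension 0. *)
Definition pd_eq (N : lmodType R) (n : nat) :=
  pd_le N n /\ forall m, pd_le N m -> (n <= m)%N.

Definition finite_left_gldim :=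
  exists m, forall N : lmodType R, pd_le N m.

End Resolutions.

(* ** Suspension and mapping cone *)

Section Suspension.
Variables (R : pzRingType) (C : complex R).

Definition susp_term (j : nat) : lmodType R :=
  if j is k.+1 then C k else 'rV[R]_0.

Definition susp_diff (j : nat) : {linear susp_term j.+1 -> susp_term j} :=
  match j return {linear susp_term j.+1 -> susp_term j} with
  | 0 => \0
  | k.+1 => \- diff C k
  end.

Lemma susp_diffK j (u : susp_term j.+2) :
  susp_diff j (susp_diff j.+1 u) = 0.
Proof. by case: j u => //= j u; rewrite linearN opprK diffK. Qed.

Definition susp : complex R := Complex susp_diffK.

End Suspension.

Section SuspensionMap.
Variables (R : pzRingType) (C D : complex R) (f : chain_map C D).

Definition susp_map_term (j : nat) : {linear susp C j -> susp D j} :=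
  match j return {linear susp C j -> susp D j} with
  | 0 => \0
  | k.+1 => f k
  end.

Lemma susp_map_termP j (u : susp C j.+1) :
  susp_map_term j (diff (susp C) j u) = diff (susp D) j (susp_map_term j.+1 u).
Proof. by case: j u => //= j u; rewrite linearN cmapP. Qed.

Definition susp_map : chain_map (susp C) (susp D) := ChainMap susp_map_termP.

End SuspensionMap.

(* Sigma^k C *)
Notation suspn k C := (iter k (@susp _) C).

(* Sigma^k f for f : Sigma C -> D, with source Sigma^k Sigma C written as
   Sigma^(k+1) C. *)
Fixpoint suspn_map (R : pzRingType) (C D : complex R) (f : chain_map (susp C) D)
    (k : nat) : chain_map (suspn k.+1 C) (suspn k D) :=
  if k is l.+1 then susp_map (suspn_map f l) else f.

(* The identification of C_m with (Sigma^k C)_(k+m), and its variant with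
   k+m replaced by some j provably equal to it. *)
Fixpoint suspn_in0 (R : pzRingType) (C : complex R) (k m : nat) :
    {linear C m -> suspn k C (k + m)%N} :=
  match k return {linear C m -> suspn k C (k + m)%N} with
  | 0 => idfun
  | l.+1 => suspn_in0 C l m
  end.

Definition suspn_in (R : pzRingType) (C : complex R) (k m j : nat)
    (e : (k + m)%N = j) : {linear C m -> suspn k C j} :=
  eq_rect (k + m)%N (fun j => {linear C m -> suspn k C j}) (suspn_in0 C k m) j e.

Section Cone.
Variables (R : pzRingType) (A B : complex R) (f : chain_map A B).

Definition cone_term (j : nat) : lmodType R := (susp A j * B j)%type.

(* susp A already carries the sign - d^A. *)
Definition cone_diff_fun (j : nat) (u : cone_term j.+1) : cone_term j :=
  (diff (susp A) j u.1, - f j u.1 + diff B j u.2).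

Lemma cone_diff_is_linear j : linear (@cone_diff_fun j).
Proof.
move=> a u v; rewrite /cone_diff_fun /= !linearP /=; congr (_, _).
by rewrite /= scalerDr addrACA.
Qed.
HB.instance Definition _ j := GRing.isLinear.Build R
  (cone_term j.+1) (cone_term j) *:%R (@cone_diff_fun j)
  (@cone_diff_is_linear j).

Definition cone_diff j : {linear cone_term j.+1 -> cone_term j} :=
  @cone_diff_fun j.

Lemma cone_diffK j (u : cone_term j.+2) : cone_diff j (cone_diff j.+1 u) = 0.
Proof.
rewrite /= /cone_diff_fun /=; congr (_, _); first exact: (diffK (c := susp A)).
by rewrite linearD diffK addr0 !linearN opprK cmapP subrr.
Qed.

Definition cone : complex R := Complex cone_diffK.

Definition cone_inl_fun j (a : susp A j) : cone j := (a, 0).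
Lemma cone_inl_is_linear j : linear (@cone_inl_fun j).
Proof. by move=> a u v; congr (_, _); rewrite /= scaler0 addr0. Qed.
HB.instance Definition _ j := GRing.isLinear.Build R (susp A j) (cone j) *:%R
  (@cone_inl_fun j) (@cone_inl_is_linear j).

(* The inclusion of the first summand; not a chain map in general. *)
Definition cone_inl j : {linear susp A j -> cone j} := @cone_inl_fun j.

Definition cone_in_fun j (b : B j) : cone j := (0, b).
Lemma cone_in_is_linear j : linear (@cone_in_fun j).
Proof. by move=> a u v; congr (_, _); rewrite /= scaler0 addr0. Qed.
HB.instance Definition _ j := GRing.isLinear.Build R (B j) (cone j) *:%R
  (@cone_in_fun j) (@cone_in_is_linear j).

Lemma cone_in_funP j (b : B j.+1) :
  cone_in_fun (diff B j b) = diff cone j (cone_in_fun b).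
Proof.
by rewrite /= /cone_diff_fun /cone_in_fun /= !linear0 add0r.
Qed.

Definition cone_in : chain_map B cone :=
  @ChainMap _ B cone (fun j => @cone_in_fun j) cone_in_funP.

Definition cone_out_fun j (u : cone j) : susp A j := u.1.
Lemma cone_out_is_linear j : linear (@cone_out_fun j).
Proof. by []. Qed.
HB.instance Definition _ j := GRing.isLinear.Build R (cone j) (susp A j) *:%R
  (@cone_out_fun j) (@cone_out_is_linear j).

Lemma cone_out_funP j (u : cone j.+1) :
  cone_out_fun (diff cone j u) = diff (susp A) j (cone_out_fun u).
Proof. by []. Qed.

Definition cone_out : chain_map cone (susp A) :=
  @ChainMap _ cone (susp A) (fun j => @cone_out_fun j) cone_out_funP.

End Cone.

(* ** Reduction of a complex modulo x and the chain map Psi *)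

Section ReducedComplex.
Variables (R : pzRingType) (x : R) (xC : central x) (P : complex R).

Definition red_complex_diff j : {linear red xC (P j.+1) -> red xC (P j)} :=
  red_map xC (diff P j).

Lemma red_complex_diffK j (u : red xC (P j.+2)) :
  red_complex_diff j (red_complex_diff j.+1 u) = 0.
Proof.
rewrite -(to_red_repr u) /red_complex_diff /= !red_mapE diffK.
by apply/to_red_eq0; exists 0; rewrite scaler0.
Qed.

Definition red_complex : complex (quoring xC) := Complex red_complex_diffK.

(* phi j is the component P_j -> P_(j+1) of a null-homotopy of multiplication
   by x. *)
Definition null_homotopy (phi : forall j, {linear P j -> P j.+1}) :=
  (forall u : P 0%N, diff P 0 (phi 0%N u) = x *: u) /\
  (forall j (u : P j.+1),
    phi j (diff P j u) + diff P j.+1 (phi j.+1 u) = x *: u).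

Variables (phi : forall j, {linear P j -> P j.+1}) (phiP : null_homotopy phi).

Definition Psi_term j : {linear susp red_complex j -> red_complex j} :=
  match j return {linear susp red_complex j -> red_complex j} with
  | 0 => \0
  | k.+1 => red_map xC (phi k)
  end.

Lemma Psi_termP j (u : susp red_complex j.+1) :
  Psi_term j (diff (susp red_complex) j u) =
  diff red_complex j (Psi_term j.+1 u).
Proof.
case: j u => [|j] u; rewrite /= -(to_red_repr u).
  rewrite !red_mapE.
  by apply/esym/to_red_eq0; exists (repr (u : quomod _)); rewrite phiP.1.
rewrite linearN /= !red_mapE; apply/eqP; rewrite eq_sym -addr_eq0; apply/eqP.
rewrite -to_redD; apply/to_red_eq0; exists (repr (u : quomod _)).
by rewrite addrC phiP.2.
Qed.

Definition Psi : chain_map (susp red_complex) red_complex :=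
  ChainMap Psi_termP.

End ReducedComplex.

(* ** The iterated cones *)

Section Tower.
Variables (R : pzRingType) (C : complex R) (f : chain_map (susp C) C).

(* A possible value of the pair (M^i, psi^(i+1)). *)
Record stage (i : nat) := Stage {
  stage_complex : complex R;
  stage_map : chain_map (suspn i.*2.+1 C) stage_complex }.

(* The successive choices of the maps psi: from (M^i, psi^(i+1)) one gets
   psi^(i+2), with target M^(i+1) = Con(psi^(i+1)). Any sequence of choices
   along the tower is the restriction of such a function. *)
Definition choices := forall (i : nat) (s : stage i),
  chain_map (suspn i.*2.+3 C) (cone (stage_map s)).

Variable c : choices.

Fixpoint tower (i : nat) : stage i :=
  match i return stage i with
  | 0 => @Stage 0 C f
  | k.+1 => @Stage k.+1 (cone (stage_map (tower k))) (c (tower k))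
  end.

(* M i is M^i, but psi i is psi^(i+1), etaM i is eta^i and nuM i is nu^(i+1). *)
Definition M (i : nat) : complex R := stage_complex (tower i).
Definition psi (i : nat) : chain_map (suspn i.*2.+1 C) (M i) :=
  stage_map (tower i).
Definition etaM (i : nat) : chain_map (M i) (M i.+1) := cone_in (psi i).
Definition nuM (i : nat) : chain_map (M i.+1) (suspn i.*2.+2 C) :=
  cone_out (psi i).

(* g is a possible psi^(i+2). *)
Definition is_lift (i : nat) (g : chain_map (suspn i.*2.+3 C) (M i.+1)) :=
  forall j (u : suspn i.*2.+3 C j), nuM i j (g j u) = suspn_map f i.*2.+2 j u.

(* psi^(k+1)_(m+1) : C_m -> M^k_j, where j = 2k+1+m. *)
Definition psi_at (k m j : nat) (e : (k.*2.+1 + m)%N = j) :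
    {linear C m -> M k j} :=
  psi k j \o suspn_in C e.

(* The inclusion C_m -> M^(k+1)_j of the first summand, where j = 2(k+1)+m. *)
Definition inl_at (k m j : nat) (e : (k.+1.*2 + m)%N = j) :
    {linear C m -> M k.+1 j} :=
  @cone_inl _ _ _ (psi k) j \o @suspn_in _ C k.+1.*2 m j e.

(* The terms and differentials of M^i for i = k+1 > 0, by ranges of degrees.
   Each term is identified through inl_at and etaM with the sum of those of its
   summands C_m (m = j-2i) and M^(i-1)_j which do not lie outside the ranges
   0..n and 0..2(i-1)+n where C and M^(i-1) live.  The differential given by a
   matrix is written as the image of a row vector (a, b), that is, of
   inl_at a + etaM b; recall that diff _ j goes from degree j+1 to degree j. *)
Record explicit_terms (n k : nat) : Prop := {
  terms_low : forall j, (j < k.+1.*2)%N -> bijective (etaM k j);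
  terms_mid : forall m j (e : (k.+1.*2 + m)%N = j), (m.+2 <= n)%N ->
    bijective (fun p : C m * M k j => inl_at e p.1 + etaM k j p.2);
  terms_high : forall m j (e : (k.+1.*2 + m)%N = j), m.+1 = n \/ m = n ->
    bijective (inl_at e);
  terms_zero : forall j, (k.+1.*2 + n < j)%N -> is_zero (M k.+1 j) }.

Record explicit_diffs (n k : nat) : Prop := {
  diffs_low : forall j (b : M k j.+1), (j.+1 < k.+1.*2)%N ->
    diff (M k.+1) j (etaM k j.+1 b) = etaM k j (diff (M k) j b);
  diffs_2i : forall j (e : (k.+1.*2 + 0)%N = j.+1) (e' : (k.*2.+1 + 0)%N = j)
      (a : C 0%N) (b : M k j.+1),
    diff (M k.+1) j (inl_at e a + etaM k j.+1 b) =
    etaM k j (- psi_at e' a + diff (M k) j b);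
  diffs_mid : forall m j (e : (k.+1.*2 + m.+1)%N = j.+1)
      (e0 : (k.+1.*2 + m)%N = j) (e' : (k.*2.+1 + m.+1)%N = j)
      (a : C m.+1) (b : M k j.+1), (m.+3 <= n)%N ->
    diff (M k.+1) j (inl_at e a + etaM k j.+1 b) =
    inl_at e0 (diff C m a) + etaM k j (- psi_at e' a + diff (M k) j b);
  diffs_penult : forall m j (e : (k.+1.*2 + m.+1)%N = j.+1)
      (e0 : (k.+1.*2 + m)%N = j) (e' : (k.*2.+1 + m.+1)%N = j)
      (a : C m.+1), m.+2 = n ->
    diff (M k.+1) j (inl_at e a) =
    inl_at e0 (diff C m a) + etaM k j (- psi_at e' a);
  diffs_top : forall m j (e : (k.+1.*2 + m.+1)%N = j.+1)
      (e0 : (k.+1.*2 + m)%N = j) (a : C m.+1), m.+1 = n ->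
    diff (M k.+1) j (inl_at e a) = inl_at e0 (diff C m a) }.

End Tower.

Arguments etaM {R C} f c i.
Arguments nuM {R C} f c i.


(* ** Direct limits of sequences of complexes *)

Section DirectLimit.
Variables (R : pzRingType) (X : nat -> complex R).
Variable f : forall i, chain_map (X i) (X i.+1).

Definition cocone (L : complex R) (h : forall i, chain_map (X i) L) :=
  forall i j (u : X i j), h i.+1 j (f i j u) = h i j u.

Definition factors (L L' : complex R) (h : forall i, chain_map (X i) L)
    (h' : forall i, chain_map (X i) L') (g : chain_map L L') :=
  forall i j (u : X i j), g j (h i j u) = h' i j u.

Definition is_direct_limit (L : complex R) (h : forall i, chain_map (X i) L) :=
  cocone h /\
  forall (L' : complex R) (h' : forall i, chain_map (X i) L'), cocone h' ->
    (exists g, factors h h' g) /\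
    (forall g g', factors h h' g -> factors h h' g' -> forall j, g j =1 g' j).

End DirectLimit.

(* Main.v *)
(** As x is regular on the P_j, the complex P/xP has homology N in degrees 0
and 1 only, and Psi identifies the two: u in P_1 is a cycle modulo x iff
du = xw, and then u - phi w is a boundary.  Suppose that M^i has homology N in
degrees 0 and 2i+1 only and that psi^(i+1) is an isomorphism on H_(2i+1).
Coning off psi^(i+1) kills H_(2i+1) and, as nu is then an isomorphism on
H_(2i+3), moves the other copy of N to degree 2i+3; a lift of Psi along nu is an
isomorphism there because Psi is one on H_1.  Such a lift exists because its
obstruction is a chain map from projectives in degrees >= 2i+2 to M^i, which is
exact in these degrees, so that it is null-homotopic.  Degreewise the tower is
eventually constant, so its limit is computed degree by degree. *)

From HB Require Import structures.
Require Import Defs.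
From mathcomp Require Import all_boot all_algebra.
From mathcomp Require Import boolp.
Import GRing.Theory.

Set Implicit Arguments.
Unset Strict Implicit.
Unset Printing Implicit Defensive.

Local Open Scope ring_scope.

(** * Linear maps, projective modules and finitely generated modules *)

Section Modules.
Variable R : pzRingType.
Implicit Types U V W : lmodType R.

(** The sigma type makes the bundled map available as data, which degreewise constructions of chain
    maps require. *)
Lemma linear_pack V W (f : V -> W) :
  linear f -> {g : {linear V -> W} | g =1 f}.
Proof.
move=> lin_f.
pose F : {linear V -> W} := HB.pack f (GRing.isLinear.Build R V W *:%R f lin_f).
by exists F.
Qed.

Lemma linear_inverse V W (f : {linear V -> W}) :
  bijective f -> exists2 g : {linear W -> V}, cancel f g & cancel g f.
Proof.
move=> [g fK gK].
have [h hE] := linear_pack (can2_linear fK gK).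
by exists h => u; rewrite hE.
Qed.

Lemma inj_surj_bijective V W (f : V -> W) :
  injective f -> (forall y, exists u, f u = y) -> bijective f.
Proof.
move=> f_inj /choice[g gK]; exists g => // u.
exact/f_inj/gK.
Qed.

Lemma linear_injective V W (f : {linear V -> W}) :
  (forall u, f u = 0 -> u = 0) -> injective f.
Proof.
move=> f0 u v fuv; apply/subr0_eq/f0.
by rewrite linearB fuv subrr.
Qed.

Lemma isomorphic_sym V W : isomorphic V W -> isomorphic W V.
Proof. by move=> [f /linear_inverse[g fK gK]]; exists g, f. Qed.

Lemma isomorphic_trans U V W :
  isomorphic U V -> isomorphic V W -> isomorphic U W.
Proof. by move=> [f bf] [g bg]; exists (g \o f); exact: bij_comp. Qed.

Lemma projective_zero V : is_zero V -> projective V.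
Proof. by move=> V0 A B g f _; exists \0 => v; rewrite (V0 v) !linear0. Qed.

Lemma pair_inl_linear V W : linear (fun v : V => (v, 0) : (V * W)%type).
Proof. by move=> a u v; congr (_, _); rewrite /= scaler0 addr0. Qed.

Lemma pair_inr_linear V W : linear (fun w : W => (0, w) : (V * W)%type).
Proof. by move=> a u v; congr (_, _); rewrite /= scaler0 addr0. Qed.

Lemma projective_prod V W :
  projective V -> projective W -> projective (V * W)%type.
Proof.
move=> pV pW A B g f g_surj.
have [i1 i1E] := linear_pack (@pair_inl_linear V W).
have [i2 i2E] := linear_pack (@pair_inr_linear V W).
have [h1 h1P] := pV _ _ g (f \o i1) g_surj.
have [h2 h2P] := pW _ _ g (f \o i2) g_surj.
have lin : linear (fun p : V * W => h1 p.1 + h2 p.2).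
  by move=> a u v; rewrite !linearP /= scalerDr addrACA.
have [h hE] := linear_pack lin.
exists h => -[v w]; rewrite hE linearD h1P h2P /= -linearD i1E i2E.
by congr (f (_, _)); rewrite /= ?addr0 ?add0r.
Qed.

Lemma projective_iso V W : isomorphic V W -> projective V -> projective W.
Proof.
move=> [i /linear_inverse[i' iK i'K]] pV A B g f g_surj.
have [h hP] := pV _ _ g (f \o i) g_surj.
by exists (h \o i') => w; rewrite hP /= i'K.
Qed.

Lemma fin_gen_surj V W (f : {linear V -> W}) :
  (forall w, exists v, f v = w) -> fin_gen V -> fin_gen W.
Proof.
move=> f_surj [k [g gP]]; exists k, (f \o g) => w.
have [v <-] := f_surj w; have [c ->] := gP v; exists c.
by rewrite linear_sum; apply: eq_bigr => i _; rewrite linearZ.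
Qed.

Lemma fin_gen_zero V : is_zero V -> fin_gen V.
Proof.
move=> V0; exists 0%N, (fun=> 0) => v; exists (fun=> 0).
by rewrite big_ord0 (V0 v).
Qed.

Lemma fin_gen_prod V W : fin_gen V -> fin_gen W -> fin_gen (V * W)%type.
Proof.
move=> [k [g gP]] [l [h hP]].
have [i1 i1E] := linear_pack (@pair_inl_linear V W).
have [i2 i2E] := linear_pack (@pair_inr_linear V W).
exists (k + l)%N,
  (fun i => match split i with inl j => i1 (g j) | inr j => i2 (h j) end).
move=> [v w]; have [c vE] := gP v; have [d wE] := hP w.
exists (fun i => match split i with inl j => c j | inr j => d j end).
have -> : (v, w) = i1 v + i2 w.
  by rewrite i1E i2E; congr (_, _); rewrite /= ?addr0 ?add0r.
rewrite big_split_ord {1}vE {1}wE !linear_sum /=; congr (_ + _).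
  by apply: eq_bigr => i _; rewrite linearZ (unsplitK (inl i)).
by apply: eq_bigr => i _; rewrite linearZ (unsplitK (inr i)).
Qed.

(* A finitely generated projective module embeds into some R^k. *)
Lemma fin_gen_projective_lreg V (x : R) : GRing.lreg x ->
  fin_gen V -> projective V -> forall u : V, x *: u = 0 -> u = 0.
Proof.
move=> x_reg [k [g gP]] pV u xu0.
have lin : linear (fun c : 'rV[R]_k => \sum_(i < k) c 0 i *: g i).
  move=> a b c; rewrite scaler_sumr -big_split /=; apply: eq_bigr => i _.
  by rewrite !mxE scalerDl scalerA.
have [p pE] := linear_pack lin.
have [v|h hP] := pV _ _ p idfun.
  have [c ->] := gP v; exists (\row_i c i).
  by rewrite pE; apply: eq_bigr => i _; rewrite mxE.
suff hu0 : h u = 0 by rewrite -[u]hP hu0 linear0.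
apply/rowP => i; rewrite mxE; apply: x_reg; rewrite mulr0.
have := congr1 (fun c : 'rV[R]_k => c 0 i) (linearZZ h x u).
by rewrite /= xu0 linear0 !mxE => ->.
Qed.

End Modules.

(** * Homology through cycles and boundaries *)

Section ElementwiseHomology.
Variable R : pzRingType.
Implicit Types A B C D : complex R.

(** Working with representatives keeps quotients out of the diagram chases; [homology_map_bijective]
    and [homology_isomorphic] return to [homology] at the end. *)
Definition is_bound C j (u : C j) := exists v, u = diff C j v.

Definition exact_at C j := forall u : C j, is_cycle u -> is_bound u.

Definition homology_inj A B (f : chain_map A B) j :=
  forall a : A j, is_cycle a -> is_bound (f j a) -> is_bound a.

Definition homology_surj A B (f : chain_map A B) j :=
  forall b : B j, is_cycle b ->
    exists a b', is_cycle a /\ b = f j a + diff B j b'.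

(* [e] induces an isomorphism from the homology in degree [j] to [V]. *)
Definition homology_coordinate C j (V : lmodType R) (e : {linear C j -> V}) :=
  (forall y, exists2 u, is_cycle u & e u = y) /\
  (forall u, is_cycle u -> (e u = 0 <-> is_bound u)).

Lemma bound_cycle C j (u : C j) : is_bound u -> is_cycle u.
Proof. by move=> [v ->]; case: j u v => //= j u v; rewrite diffK. Qed.

Lemma cycleN C j (u : C j) : is_cycle u -> is_cycle (- u).
Proof.
by move=> cu; rewrite -scaleN1r -[_ *: u]addr0; exact/is_cycleP/is_cycle0.
Qed.

Lemma cycleD C j (u v : C j) : is_cycle u -> is_cycle v -> is_cycle (u + v).
Proof. by move=> cu cv; rewrite -[u]scale1r; apply: is_cycleP. Qed.

Lemma cycleB C j (u v : C j) : is_cycle u -> is_cycle v -> is_cycle (u - v).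
Proof. by move=> cu cv; apply/cycleD/cycleN. Qed.

Lemma cycle_cmap A B (f : chain_map A B) j (u : A j) :
  is_cycle u -> is_cycle (f j u).
Proof. by case: j u => //= j u u0; rewrite -cmapP u0 linear0. Qed.

Lemma quo_eq0 (V : lmodType R) (U : submodule V) u : quo U u = 0 <-> U u.
Proof.
have -> : (0 : quomod U) = quo U 0 by rewrite linear0.
by rewrite quoP subr0.
Qed.

Definition cycle_sub C j (u : C j) (cu : is_cycle u) : submod (cycles C j) :=
  Sub u (asboolT cu).

Lemma val_cycle C j (z : submod (cycles C j)) : is_cycle (val z).
Proof. exact/asboolP/(valP z). Qed.

Lemma exact_homology C j : exact_at C j -> is_zero (homology C j).
Proof.
move=> ex q; rewrite -(quo_repr q); apply/quo_eq0.
exact/ex/val_cycle.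
Qed.

Lemma homology_mapE A B (f : chain_map A B) j (z : submod (cycles A j)) :
  homology_map f j (quo _ z) = quo _ (Defs.cycle_map f z).
Proof. exact: quomapE. Qed.

Lemma homology_map_bijective A B (f : chain_map A B) j :
  homology_inj f j -> homology_surj f j -> bijective (homology_map f j).
Proof.
move=> f_inj f_surj; apply: inj_surj_bijective.
  apply: linear_injective => q; rewrite -(quo_repr q) homology_mapE.
  move=> /quo_eq0 fz.
  apply/quo_eq0; apply: f_inj; [exact: val_cycle | exact: fz].
move=> q; have [a [b' [ca bE]]] := f_surj _ (val_cycle (repr q)).
exists (quo _ (cycle_sub ca)); rewrite homology_mapE -[RHS]quo_repr.
apply/quoP; exists (- b'); rewrite linearN /=.
by rewrite [X in _ - X]bE opprD addrA subrr add0r.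
Qed.

Lemma homology_isomorphic C j (V : lmodType R) (e : {linear C j -> V}) :
  homology_coordinate e -> isomorphic (homology C j) V.
Proof.
move=> [e_surj e_ker].
pose F (q : homology C j) := e (val (repr q)).
have FE z : F (quo _ z) = e (val z).
  apply/subr0_eq; rewrite -linearB.
  have /quoP[v /= vE] := quo_repr (quo (boundaries C j) z).
  have bv : is_bound (diff C j v) by exists v.
  by rewrite vE; apply/e_ker => //; exact: bound_cycle.
have F_lin : linear F.
  move=> a p q; rewrite -(quo_repr p) -(quo_repr q) -linearP !FE.
  by rewrite /= linearP.
have [G GE] := linear_pack F_lin; exists G.
apply: inj_surj_bijective => [|y].
  apply: linear_injective => q; rewrite GE -(quo_repr q) FE => ez.
  by apply/quo_eq0/e_ker => //; exact: val_cycle.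
have [u cu <-] := e_surj y.
by exists (quo _ (cycle_sub cu)); rewrite GE FE.
Qed.

(** [susp C j.+1] is convertible to [C j], and the differentials differ by a sign. For [j = 0] both
    sides hold trivially, as [susp C] has zero differential into degree 0. *)
Lemma susp_cycle C j (u : C j) : is_cycle (u : susp C j.+1) <-> is_cycle u.
Proof.
case: j u => //= j u; split=> [/eqP|->]; last by rewrite oppr0.
by rewrite oppr_eq0 => /eqP.
Qed.

Lemma susp_bound C j (u : C j) : is_bound (u : susp C j.+1) <-> is_bound u.
Proof.
by split=> -[v vE]; exists (- v); rewrite linearN ?vE //= opprK.
Qed.

Lemma exact_zero C j : is_zero (C j) -> exact_at C j.
Proof. by move=> C0 u _; exists 0; rewrite (C0 u) linear0. Qed.

Lemma susp0_zero C : is_zero (susp C 0%N).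
Proof. by move=> u; apply/matrixP => i []. Qed.

Lemma susp_exact C j : exact_at C j -> exact_at (susp C) j.+1.
Proof. by move=> ex u /susp_cycle/ex/susp_bound. Qed.

Lemma susp_homology_inj A B (f : chain_map A B) j :
  homology_inj f j -> homology_inj (susp_map f) j.+1.
Proof.
by move=> f_inj a /susp_cycle ca /susp_bound fa; apply/susp_bound/f_inj.
Qed.

Lemma susp_homology_surj A B (f : chain_map A B) j :
  homology_surj f j -> homology_surj (susp_map f) j.+1.
Proof.
move=> f_surj b /susp_cycle/f_surj[a [b' [/susp_cycle ca bE]]].
exists a, (- b'); split=> //.
by rewrite bE linearN /= opprK.
Qed.

Lemma suspn_homology_coordinate C (V : lmodType R) (e : {linear C 0%N -> V}) k :
  homology_coordinate e ->
  exists e' : {linear suspn k C k -> V}, homology_coordinate e'.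
Proof.
move=> eP; elim: k => [|k [e' [e'_surj e'_ker]]]; first by exists e.
exists e'; split=> [y|u /susp_cycle cu].
  by have [u cu <-] := e'_surj y; exists u => //; exact/susp_cycle.
by rewrite (e'_ker u cu); apply: iff_sym; exact: susp_bound.
Qed.

Lemma suspn_zero C k j : (j < k)%N -> is_zero (suspn k C j).
Proof.
elim: k j => [|k IHk] [|j] //; first by move=> _; apply: susp0_zero.
exact: IHk.
Qed.

Lemma suspn_exact C k m : exact_at C m -> exact_at (suspn k C) (k + m).
Proof. by move=> ex; elim: k => [//|k IHk]; apply: susp_exact. Qed.

Lemma suspn_homology_inj C D (f : chain_map (susp C) D) k m :
  homology_inj f m -> homology_inj (suspn_map f k) (k + m).
Proof. by move=> f_inj; elim: k => [//|k IHk]; apply: susp_homology_inj. Qed.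

Lemma suspn_homology_surj C D (f : chain_map (susp C) D) k m :
  homology_surj f m -> homology_surj (suspn_map f k) (k + m).
Proof. by move=> f_surj; elim: k => [//|k IHk]; apply: susp_homology_surj. Qed.

(** Each term of a suspension is a term of [C] or the padding ['rV_0]; this carries [projective] and
    [fin_gen] over. *)
Lemma suspn_degree_ind (Q : lmodType R -> Prop) C k j :
  (forall V, is_zero V -> Q V) -> (forall m, Q (C m)) -> Q (suspn k C j).
Proof.
move=> Q0 QC; elim: k j => [|k IHk] [|j] //=.
exact/Q0/(@susp0_zero (suspn k C)).
Qed.

End ElementwiseHomology.

(** * Homology of a mapping cone and of lifts to it *)

Section ConeHomology.
Variables (R : pzRingType) (A B : complex R) (f : chain_map A B).

Lemma cone_cycle j (a : A j) (b : B j.+1) :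
  is_cycle ((a, b) : cone f j.+1) <->
  is_cycle (a : susp A j.+1) /\ f j a = diff B j b.
Proof.
split=> [[da /eqP fab]|[da fab]].
  by split=> //; apply/esym/eqP; rewrite -subr_eq0 addrC.
by congr (_, _); rewrite //= fab addNr.
Qed.

(* Subtracting the boundary of [(a', 0)] moves a cone cycle whose first
   component is a boundary into [B]. *)
Lemma cone_bound j (a : A j) (b : B j.+1) :
  is_cycle ((a, b) : cone f j.+1) -> is_bound (a : susp A j.+1) ->
  exact_at B j.+1 -> is_bound ((a, b) : cone f j.+1).
Proof.
move=> /cone_cycle[_ fab] [a' aE] exB.
have /exB[b' bE] : is_cycle (b + f j.+1 a').
  by rewrite /= linearD -fab -cmapP aE linearN addNr.
by exists (a', b'); rewrite /= /cone_diff_fun /= -bE addrC addrK aE.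
Qed.

(** In the long exact sequence of [B -> cone f -> susp A] the middle term vanishes with both
    neighbours. *)
Lemma cone_exact j :
  exact_at (susp A) j -> exact_at B j -> exact_at (cone f) j.
Proof.
case: j => [|j] exA exB [a b] cab.
  have [b' ->] : is_bound b by apply: exB.
  exists (0, b'); congr (_, _); first exact: (susp0_zero a).
  by rewrite linear0 oppr0 add0r.
by apply: cone_bound => //; have /cone_cycle[/exA] := cab.
Qed.

Lemma cone_cycle2 j (u : cone f j) : is_cycle u -> u.1 = 0 -> is_cycle u.2.
Proof.
case: j u => //= j [a b] /cone_cycle[_ /= <-] ->.
by rewrite linear0.
Qed.

(** Up to sign, [f] is the connecting map from the homology of [susp A] to that of [B]; being
    surjective, it kills the latter. *)
Lemma cone_exact_surj j :
  is_zero (susp A j) -> homology_surj f j -> exact_at (cone f) j.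
Proof.
move=> A0 f_surj [a b] cab; have cb : is_cycle b.
  exact/(cone_cycle2 cab)/A0.
have [a' [b' [ca' bE]]] := f_surj _ cb.
(* The sign cancels the one before [f] in the differential of the cone. *)
exists (- a' : susp A j.+1, b'); congr (_, _); first by rewrite (A0 a) [RHS]A0.
by rewrite linearN opprK.
Qed.

(** An injective connecting map lets only boundaries of [susp A] lift to cycles of the cone. *)
Lemma cone_exact_inj j :
  homology_inj f j -> exact_at B j.+1 -> exact_at (cone f) j.+1.
Proof.
move=> f_inj exB [a b] cab; have /cone_cycle[/susp_cycle ca fab] := cab.
by apply: cone_bound => //; apply/susp_bound/f_inj => //; exists b.
Qed.

Section LiftHomology.
Variables (D : complex R) (g : chain_map D (cone f)).
Variable (h : chain_map D (susp A)).
Hypothesis gh : forall j u, cone_out f j (g j u) = h j u.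

Lemma lift_homology_inj j : homology_inj h j -> homology_inj g j.
Proof.
move=> h_inj d cd [ab gE]; apply: h_inj => //.
by exists (cone_out f _ ab); rewrite -gh gE -cmapP.
Qed.

(** Exactness of [B] makes [cone_out f] injective on homology in degree [j], so surjectivity passes
    from [h] to [g]. *)
Lemma lift_homology_surj j :
  homology_surj h j -> exact_at B j -> homology_surj g j.
Proof.
move=> h_surj exB u cu.
have [d [a [cd uE]]] := h_surj _ (cycle_cmap (cone_out f) cu).
(* The boundary of [(a, 0)] clears the first component, so that [z] is a cycle of [B]. *)
pose z := u - g j d - diff (cone f) j (a, 0).
have cz : is_cycle z.
  apply: cycleB; last by apply: bound_cycle; exists (a, 0).
  by apply: cycleB => //; exact: cycle_cmap.
have z1 : cone_out f j z = 0.
  by rewrite /z 2!linearB gh uE cmapP [_ + diff _ _ _]addrC addrK subrr.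
have [b z2] := exB _ (cone_cycle2 cz z1).
have zE : z = diff (cone f) j (0, b).
  rewrite [LHS]surjective_pairing z2 [z.1]z1; congr (_, _).
    by rewrite /= linear0.
  by rewrite /= linear0 oppr0 add0r.
exists d, ((a, 0) + (0, b)); split=> //.
by rewrite linearD -zE /z [_ + (_ - _)]addrC subrK addrC subrK.
Qed.
End LiftHomology.

End ConeHomology.

(** * Null-homotopies and lifts to a cone *)

Section NullHomotopy.
Variables (R : pzRingType) (A B : complex R) (theta : chain_map A B).

(** By exactness [diff B j] is onto the cycles, to which [tau] corestricts. The case [is_zero V]
    serves the low degrees of a suspension, where [B] may fail to be exact. *)
Lemma projective_lift_cycles (V : lmodType R) j (tau : {linear V -> B j}) :
  projective V -> is_zero V \/ exact_at B j -> (forall u, is_cycle (tau u)) ->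
  exists t : {linear V -> B j.+1}, forall u, tau u = diff B j (t u).
Proof.
move=> pV [V0 _|exB ctau].
  by exists \0 => u; rewrite (V0 u) !linear0.
have cd v : is_cycle (diff B j v) by apply: bound_cycle; exists v.
have lin1 : linear (fun v => cycle_sub (cd v)).
  by move=> a u v; apply/val_inj; rewrite /= linearP.
have lin2 : linear (fun u => cycle_sub (ctau u)).
  by move=> a u v; apply/val_inj; rewrite /= linearP.
have [g gE] := linear_pack lin1; have [f fE] := linear_pack lin2.
have [z|t tP] := pV _ _ g f.
  have [v zE] := exB _ (val_cycle z); exists v.
  by apply/val_inj; rewrite gE.
exists t => u; have /(congr1 val) := tP u.
by rewrite gE fE.
Qed.

Hypothesis projA : forall j, projective (A j).
Hypothesis exAB : forall j, is_zero (A j) \/ exact_at B j.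

Lemma null_homotopy_exists : exists t : forall j, {linear A j -> B j.+1},
  (forall u : A 0%N, theta 0 u = diff B 0 (t 0%N u)) /\
  (forall j (u : A j.+1),
    theta j.+1 u = diff B j.+1 (t j.+1 u) + t j (diff A j u)).
Proof.
(* The invariant of the recursion says that [theta j.+1] minus [t] after [diff A j] takes values in
   cycles, as the next lifting step requires. *)
pose S j := {t : {linear A j -> B j.+1} |
  forall u, diff B j (t (diff A j u)) = theta j (diff A j u)}.
have /cid[t0 t0P] : exists t0 : {linear A 0%N -> B 1%N},
    forall u, theta 0 u = diff B 0 (t0 u).
  exact: projective_lift_cycles.
have step j (s : S j) : {s' : S j.+1 | forall u,
    theta j.+1 u = diff B j.+1 (sval s' u) + sval s (diff A j u)}.
  have lin : linear (fun u => theta j.+1 u - sval s (diff A j u)).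
    move=> a u v; rewrite (linearP (theta j.+1)) (linearP (diff A j)).
    by rewrite (linearP (sval s)) opprD addrACA scalerBr.
  have [tau tauE] := linear_pack lin.
  have /cid[t tP] : exists t : {linear A j.+1 -> B j.+2},
      forall u, tau u = diff B j.+1 (t u).
    apply: projective_lift_cycles => // u.
    by rewrite tauE /= linearB (proj2_sig s) cmapP subrr.
  have tP' u : theta j.+1 u = diff B j.+1 (t u) + sval s (diff A j u).
    by rewrite -tP tauE subrK.
  have tS u : diff B j.+1 (t (diff A j.+1 u)) = theta j.+1 (diff A j.+1 u).
    by rewrite tP' diffK linear0 addr0.
  by exists (exist _ t tS).
pose s := nat_rect S (exist _ t0 (fun u => esym (t0P _)))
  (fun j s => sval (step j s)).
exists (fun j => sval (s j)); split=> [u|j u]; first exact: t0P.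
exact: (proj2_sig (step j (s j))).
Qed.

End NullHomotopy.

Section ConeLift.
Variables (R : pzRingType) (A B D : complex R) (f : chain_map A B).
Variable h : chain_map D A.
Hypothesis projD : forall j, projective (D j).
Hypothesis exDB : forall j, is_zero (D j) \/ exact_at B j.

(* The obstruction to lifting is the class of [h] followed by [f], which is
   null-homotopic. *)
Lemma cone_lift : exists g : chain_map (susp D) (cone f),
  forall j u, cone_out f j (g j u) = susp_map h j u.
Proof.
have fhP j (u : D j.+1) :
    (f j \o h j) (diff D j u) = diff B j ((f j.+1 \o h j.+1) u).
  by rewrite /= !cmapP.
pose theta : chain_map D B :=
  @ChainMap _ D B (fun j => f j \o h j) fhP.
have [t [t0P tSP]] := null_homotopy_exists theta projD exDB.
(* The null-homotopy, reindexed along the suspension, is the second component of the lift. *)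
pose s j : {linear susp D j -> B j} :=
  match j return {linear susp D j -> B j} with 0 => \0 | k.+1 => t k end.
pose gf j (u : susp D j) : cone f j := (susp_map h j u, s j u).
have g_lin j : linear (@gf j).
  by move=> a u v; rewrite /gf !linearP.
pose G j : {linear susp D j -> cone f j} := sval (linear_pack (@g_lin j)).
have GE j u : G j u = gf j u by rewrite /G; case: linear_pack.
have GP j (u : susp D j.+1) :
    G j (diff (susp D) j u) = diff (cone f) j (G j.+1 u).
  rewrite !GE /gf; congr (_, _).
    by rewrite (cmapP (susp_map h)).
  case: j u => [|j] u /=.
    by rewrite [f _ _]t0P addNr.
  by rewrite [f _ _]tSP linearN opprD addrAC addNr add0r.
by exists (ChainMap GP) => j u; rewrite /= GE.
Qed.

End ConeLift.

(** * Reduction modulo x *)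

Section ReductionModules.
Variables (R : pzRingType) (x : R) (xC : central x).
Implicit Types V : lmodType R.

Lemma to_red0 V : to_red xC (0 : V) = 0.
Proof. by apply/to_red_eq0; exists 0; rewrite scaler0. Qed.

Lemma to_redB V (u v : V) : to_red xC (u - v) = to_red xC u - to_red xC v.
Proof.
by apply/eqP; rewrite eq_sym subr_eq -to_redD subrK.
Qed.

Lemma restr_scalex (N : lmodType (quoring xC)) (u : restr N) : x *: u = 0.
Proof.
have qx0 : qr xC x = 0.
  by rewrite -(raddf0 (qr xC)); apply/qrP; exists 1; rewrite subr0 mulr1.
by rewrite /GRing.scale /= /restr_scale qx0 scale0r.
Qed.

Section FactorReduction.
Variables (V : lmodType R) (N : lmodType (quoring xC)).
Variable f : {linear V -> restr N}.

(** As [x] acts as zero on [restr N], [f] kills [xV]: the universal property of extension of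
    scalars. *)
Lemma red_factor : exists g : {linear red xC V -> N},
  forall v, g (to_red xC v) = f v.
Proof.
pose F (q : red xC V) : N := f (repr (q : quomod _)).
have FE v : F (to_red xC v) = f v.
  (* The difference is read in [restr N], where [f] is linear. *)
  apply/subr0_eq; rewrite /F -[_ - _]/((_ : restr N) - _) -linearB.
  have /to_redP[w ->] := to_red_repr (to_red xC v).
  by rewrite linearZZ restr_scalex.
have F_lin : linear F.
  move=> s p q; rewrite -(qr_repr s) -(to_red_repr p) -(to_red_repr q).
  by rewrite -to_redZ -to_redD !FE linearP.
have [g gE] := linear_pack F_lin.
by exists g => v; rewrite gE FE.
Qed.

End FactorReduction.

(** Maps out of [V/xV] correspond to maps from [V] into restrictions, so the lifting is done over
    [R]. *)
Lemma red_projective V : projective V -> projective (red xC V).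
Proof.
move=> pV A B g f g_surj.
have g_lin : linear (g : restr A -> restr B).
  by move=> a u v; exact: linearP.
have f_lin : linear (fun v => f (to_red xC v) : restr B).
  by move=> a u v; rewrite to_redD to_redZ linearP.
have [gR gRE] := linear_pack g_lin; have [fR fRE] := linear_pack f_lin.
have [b|h hP] := pV _ _ gR fR.
  by have [a <-] := g_surj b; exists a; rewrite gRE.
have [H HE] := red_factor h.
exists H => q; rewrite -(to_red_repr q) HE -[LHS]gRE hP fRE.
by rewrite to_red_repr.
Qed.

Lemma red_fin_gen V : fin_gen V -> fin_gen (red xC V).
Proof.
move=> [k [g gP]]; exists k, (fun i => to_red xC (g i)) => q.
have [c qE] := gP (repr (q : quomod _)); exists (fun i => qr xC (c i)).
rewrite -{1}(to_red_repr q) qE (big_morph _ (@to_redD _ _ xC V) (@to_red0 V)).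
by apply: eq_bigr => i _; rewrite to_redZ.
Qed.

End ReductionModules.

(** * Homology of P/xP and the map Psi *)

Section ReducedResolution.
Variables (R : pzRingType) (x : R) (xC : central x) (x_reg : GRing.lreg x).
Variables (N : lmodType (quoring xC)) (P : complex R).
Variable aug : {linear P 0%N -> restr N}.
Hypothesis hP : fin_type_proj_resolution aug.
Variable phi : forall j, {linear P j -> P j.+1}.
Hypothesis hphi : null_homotopy x phi.

Let Pbar := red_complex xC P.

Lemma resolution_lreg j (u : P j) : x *: u = 0 -> u = 0.
Proof. by case: hP => -[_ pP] fP; exact: fin_gen_projective_lreg. Qed.

(** The homology of P/xP in degree 0 is [N/xN], which is [N]. *)
Lemma red_augmentation : exists e : {linear Pbar 0%N -> N},
  homology_coordinate e.
Proof.
have [[[aug_surj aug_ker _] _] _] := hP.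
have [e eE] : exists e : {linear Pbar 0%N -> N},
    forall v, e (to_red xC v) = aug v := red_factor aug.
exists e; split=> [y|u _].
  by have [u <-] := aug_surj y; exists (to_red xC u).
rewrite -(to_red_repr u) eE; split=> [/aug_ker[v ->]|[v uE]].
  by exists (to_red xC v); rewrite /= red_mapE.
rewrite -eE uE -(to_red_repr v) [diff _ _ _]red_mapE eE.
by apply/aug_ker; eexists.
Qed.

Lemma red_diff_eq0 j (u : P j.+1) :
  diff Pbar j (to_red xC u) = 0 -> exists w, diff P j u = x *: w.
Proof. by rewrite /= red_mapE => /to_red_eq0. Qed.

(** If [dv = xw], then [x dw = 0], so [dw = 0] by regularity and [w = dt]; now [v - xt] is a true
    cycle with the same reduction as [v]. *)
Lemma red_exact m : exact_at Pbar m.+2.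
Proof.
have [[[_ _ exP] _] _] := hP.
move=> u; rewrite -(to_red_repr u); set v := repr _ => /red_diff_eq0[w dv].
have /exP[t wE] : diff P m w = 0.
  by apply: resolution_lreg; rewrite -linearZZ -dv diffK.
have /exP[s vE] : diff P m.+1 (v - x *: t) = 0.
  by rewrite linearB linearZZ -wE dv subrr.
exists (to_red xC s); rewrite /= red_mapE -vE to_redB.
by rewrite (_ : to_red xC (x *: t) = 0) ?subr0 //; apply/to_red_eq0; exists t.
Qed.

(** Applying [d] to [phi a - db = xt] gives [xa = x dt], hence [a = dt] by regularity. *)
Lemma Psi_homology_inj : homology_inj (Psi xC hphi) 1.
Proof.
move=> w _; rewrite -(to_red_repr (w : red xC (P 0%N))).
set a := repr _ => -[v]; rewrite -(to_red_repr v); set b := repr _.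
rewrite /= !red_mapE => /to_redP[t aE].
have aE' : a = diff P 0 t.
  apply/subr0_eq/resolution_lreg.
  by rewrite scalerBr -hphi.1 -linearZZ -aE linearB diffK subr0 subrr.
by apply/susp_bound; exists (to_red xC t); rewrite aE' /= red_mapE.
Qed.

Lemma Psi_homology_surj : homology_surj (Psi xC hphi) 1.
Proof.
have [[[_ _ exP] _] _] := hP.
move=> u; rewrite -(to_red_repr u); set v := repr _ => /red_diff_eq0[w dv].
have /exP[s vE] : diff P 0 (v - phi 0%N w) = 0.
  by rewrite linearB hphi.1 dv subrr.
exists (to_red xC w), (to_red xC s); split=> //.
by rewrite /= !red_mapE -vE to_redB addrC subrK.
Qed.

End ReducedResolution.

(** * The tower of cones *)

Section SuspensionIndexing.
Variables (R : pzRingType) (C : complex R).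

Lemma suspn_in_bijective k m j (e : (k + m)%N = j) : bijective (suspn_in C e).
Proof. by case: j / e; elim: k => [|k IHk] //=; exists id. Qed.

(** The sides differ only by casts, which uniqueness of equality proofs in [nat] removes. *)
Lemma suspn_inS k m j (e : (k + m)%N = j) (e' : (k.+1 + m)%N = j.+1) :
  suspn_in C e' = suspn_in C e.
Proof. by case: j / e e' => e'; rewrite (eq_irrelevance e' erefl). Qed.

Lemma suspn_in_diff k m j (e : (k + m.+1)%N = j.+1) (e0 : (k + m)%N = j)
    (a : C m.+1) :
  diff (suspn k C) j (suspn_in C e a) =
  (-1) ^+ k *: suspn_in C e0 (diff C m a).
Proof.
elim: k j e e0 => [|k IHk] j e e0.
  by rewrite scale1r; case: j / e0 e => e; rewrite (eq_irrelevance e erefl).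
case: j e e0 => [//|j] e e0.
have e' : (k + m.+1)%N = j.+1 by case: e.
have e0' : (k + m)%N = j by case: e0.
rewrite (suspn_inS e') (suspn_inS e0') exprS -scalerA scaleN1r -IHk.
by [].
Qed.

Lemma suspn_zero_high n k j : length_le C n -> (k + n < j)%N ->
  is_zero (suspn k C j).
Proof.
move=> Cn; elim: k j => [|k IHk] [|j] //=; first exact: Cn.
exact: IHk.
Qed.

End SuspensionIndexing.

(** * Terms and differentials of the iterated cones *)

Section TowerTerms.
Variables (R : pzRingType) (C : complex R) (f : chain_map (susp C) C).
Variable c : choices C.

Lemma tower_projective i j :
  (forall m, projective (C m)) -> projective (M f c i j).
Proof.
move=> pC; elim: i j => [|i IHi] j; first exact: pC.
apply: projective_prod; last exact: IHi.
exact: (@suspn_degree_ind _ (@projective R) C i.*2.+2 j (@projective_zero R)).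
Qed.

Lemma tower_fin_gen i j : (forall m, fin_gen (C m)) -> fin_gen (M f c i j).
Proof.
move=> fC; elim: i j => [|i IHi] j; first exact: fC.
apply: fin_gen_prod; last exact: IHi.
exact: (@suspn_degree_ind _ (@fin_gen R) C i.*2.+2 j (@fin_gen_zero R)).
Qed.

Lemma tower_eta_bijective k j : (j < k.+1.*2)%N -> bijective (etaM f c k j).
Proof.
move=> jk; exists snd => // -[a b]; congr (_, _).
exact/esym/(suspn_zero jk a).
Qed.

Lemma tower_zero n i j : length_le C n -> (i.*2 + n < j)%N ->
  is_zero (M f c i j).
Proof.
move=> Cn; elim: i j => [|i IHi] j ij; first exact: Cn.
move=> [a b]; congr (_, _); first exact: (suspn_zero_high Cn ij a).
by apply: IHi; apply: leq_trans ij; rewrite doubleS !addSn !ltnS ltnW.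
Qed.

Lemma inl_etaE k m j (e : (k.+1.*2 + m)%N = j) (a : C m) (b : M f c k j) :
  inl_at f c e a + etaM f c k j b = (suspn_in C e a, b).
Proof. by congr (_, _); rewrite /= ?addr0 ?add0r. Qed.

Lemma tower_explicit_terms n k : length_le C n -> explicit_terms f c n k.
Proof.
move=> Cn; split.
- exact: tower_eta_bijective.
- move=> m j e _; have [g gK Kg] := suspn_in_bijective C e.
  exists (fun u => (g u.1, u.2)) => [[a b]|[a b]].
    by rewrite inl_etaE gK.
  by rewrite inl_etaE Kg.
- move=> m j e mn; have [g gK Kg] := suspn_in_bijective C e.
  (* M^k ends in degree 2k+n, and [j = 2k+2+m] exceeds this once [m >= n-1]. *)
  have M0 : is_zero (M f c k j).
    apply: (tower_zero Cn); rewrite -e doubleS !addSn ltnS.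
    by case: mn => <-; rewrite ?addnS // leqW.
  exists (fun u => g u.1) => [a|[a b]]; first exact: gK.
  by congr (_, _); [exact: Kg | rewrite (M0 b)].
- by move=> j; apply: tower_zero.
Qed.

Lemma tower_diff_inl k m j (e : (k.+1.*2 + m.+1)%N = j.+1)
    (e0 : (k.+1.*2 + m)%N = j) (e' : (k.*2.+1 + m.+1)%N = j) (a : C m.+1) :
  diff (M f c k.+1) j (inl_at f c e a) =
  inl_at f c e0 (diff C m a) + etaM f c k j (- psi_at f c e' a).
Proof.
rewrite inl_etaE; congr (_, _).
  (* The summand is an even suspension, so its sign is trivial. *)
  rewrite [LHS](suspn_in_diff e e0) -signr_odd odd_double.
  by rewrite expr0 scale1r.
by rewrite /= linear0 addr0 /psi_at /= (suspn_inS C e').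
Qed.

Lemma tower_diff_inl0 k j (e : (k.+1.*2 + 0)%N = j.+1)
    (e' : (k.*2.+1 + 0)%N = j) (a : C 0%N) :
  diff (M f c k.+1) j (inl_at f c e a) = etaM f c k j (- psi_at f c e' a).
Proof.
congr (_, _).
  apply: (@suspn_zero _ C k.*2.+2 j).
  by rewrite -e' addn0.
by rewrite /= linear0 addr0 /psi_at /= (suspn_inS C e').
Qed.

Lemma tower_explicit_diffs n k : length_le C n -> explicit_diffs f c n k.
Proof.
move=> Cn; split.
- by move=> j b _; rewrite cmapP.
- by move=> j e e' a b; rewrite linearD -cmapP (tower_diff_inl0 e e') -linearD.
- move=> m j e e0 e' a b _.
  by rewrite linearD -cmapP (tower_diff_inl e e0 e') -addrA -linearD.
- by move=> m j e e0 e' a _; rewrite (tower_diff_inl e e0 e').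
- move=> m j e e0 a mn; have e' : (k.*2.+1 + m.+1)%N = j.
    by rewrite -e0 doubleS addSn addnS.
  (* The [psi] component lands in degree 2k+1+n, just above the top degree of M^k. *)
  rewrite (tower_diff_inl e e0 e') (_ : - _ = 0) ?linear0 ?addr0 //.
  by apply: (tower_zero Cn); rewrite -e' mn.
Qed.

End TowerTerms.

(** * Homology of the iterated cones and existence of the lifts *)

Section TowerHomology.
Variables (R : pzRingType) (C : complex R) (f : chain_map (susp C) C).
Variable c : choices C.
Variables (N : lmodType R) (e : {linear C 0%N -> N}).
Hypothesis eP : homology_coordinate e.
Hypothesis exC : forall m, exact_at C m.+2.
Hypotheses (f_inj : homology_inj f 1) (f_surj : homology_surj f 1).

(** The inductive invariant. The copy of [N] in degree 2i+1 is recovered from the first two fields,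
    as the source of [psi f c i] has [C 0] in that degree. *)
Record tower_homology i : Prop := {
  tower_inj : homology_inj (psi f c i) i.*2.+1;
  tower_surj : homology_surj (psi f c i) i.*2.+1;
  tower_exact : forall j, j <> 0%N -> j <> i.*2.+1 -> exact_at (M f c i) j;
  tower_aug : exists e' : {linear M f c i 0%N -> N}, homology_coordinate e' }.

Lemma tower_homology0 : tower_homology 0.
Proof.
split=> //; last by exists e.
by move=> [|[|j]] // _ _; apply: exC.
Qed.

Lemma tower_homologyS i :
  is_lift (psi f c i.+1) -> tower_homology i -> tower_homology i.+1.
Proof.
move=> lift [psi_inj psi_surj exM [e' [e'_surj e'_ker]]].
have exMS j : j <> 0%N -> j <> i.+1.*2.+1 -> exact_at (M f c i.+1) j.
  (* Surjectivity of [psi] settles degree 2i+1 and injectivity degree 2i+2; in the remaining degrees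
     both ends of the cone are exact. *)
  move=> j0 j_neq; case: (ltngtP j i.*2.+1) => [lt_ji | gt_ji | j_eq].
  - apply: cone_exact; last by apply: exM => // ji; rewrite ji ltnn in lt_ji.
    apply/exact_zero/(@suspn_zero _ C i.*2.+2).
    exact: leqW.
  - have := gt_ji; rewrite leq_eqVlt => /orP[/eqP<-|gt2_ji].
      by apply: cone_exact_inj => //; apply: exM => // -[] /esym/n_Sn.
    apply: cone_exact; last by apply: exM => // ji; rewrite ji ltnn in gt_ji.
    have [m ->] : exists m, j = (i.*2.+2 + m.+2)%N.
      exists (j - i.*2.+4)%N; rewrite !addnS -!addSn subnKC //.
      by rewrite ltn_neqAle gt2_ji andbT; apply/eqP => /esym.
    exact: (@suspn_exact _ C i.*2.+2 m.+2 (@exC m)).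
  - rewrite j_eq; apply: cone_exact_surj => //.
    exact: (@suspn_zero _ C i.*2.+2).
split=> //.
- apply: (lift_homology_inj lift).
  by have := suspn_homology_inj (k := i.*2.+2) f_inj; rewrite addn1.
- apply: (lift_homology_surj lift).
    by have := suspn_homology_surj (k := i.*2.+2) f_surj; rewrite addn1.
  by apply: exM => // ji; have := ltnW (ltnSn i.*2.+2); rewrite {1}ji ltnn.
(* Degrees 0 and 1 lie below the suspended summand, so the homology in degree 0 is unchanged. *)
exists (e' \o snd); split=> [y|[a b] _].
  by have [u _ <-] := e'_surj y; exists (0, u).
rewrite /= e'_ker //; split=> [[b' bE]|[[a' b'] abE]].
  exists (0, b'); congr (_, _); first exact: (@susp0_zero _ _ a).
  by rewrite linear0 oppr0 add0r.
exists b'; have /= -> := congr1 snd abE.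
have /= -> := @suspn_zero _ C i.*2.+1 0%N isT a'.
by rewrite linear0 oppr0 add0r.
Qed.

Lemma tower_homologyP i :
  (forall k, (k < i)%N -> is_lift (psi f c k.+1)) -> tower_homology i.
Proof.
elim: i => [|i IHi] lift; first exact: tower_homology0.
by apply: tower_homologyS; [exact: lift | apply: IHi => k /ltnW/lift].
Qed.

Lemma tower_lift_exists i : (forall m, projective (C m)) -> tower_homology i ->
  exists g : chain_map (suspn i.*2.+3 C) (M f c i.+1), is_lift g.
Proof.
move=> pC [_ _ exM _].
(* [suspn_map f i.*2.+2] is by definition [susp_map] of [suspn_map f i.*2.+1], which is the map to
   be lifted. *)
apply: (@cone_lift _ _ _ (suspn i.*2.+2 C) (psi f c i)
  (suspn_map f i.*2.+1)) => j.
  exact: (@suspn_degree_ind _ (@projective R) C i.*2.+2 j (@projective_zero R)).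
have [lt_ji|le_ij] := ltnP j i.*2.+2; [left; exact: suspn_zero | right].
by apply: exM => ji; rewrite ji ?ltnn in le_ij.
Qed.

Lemma tower_homology_isos i : tower_homology i ->
  [/\ isomorphic (homology (M f c i) 0) N,
      isomorphic (homology (M f c i) i.*2.+1) N,
      forall j, j <> 0%N -> j <> i.*2.+1 -> is_zero (homology (M f c i) j) &
      bijective (homology_map (psi f c i) i.*2.+1)].
Proof.
move=> [psi_inj psi_surj exM [e' e'P]].
have psi_bij := homology_map_bijective psi_inj psi_surj.
split=> //; first exact: (homology_isomorphic e'P).
  apply: isomorphic_trans (isomorphic_sym _) _.
    by exists (homology_map (psi f c i) i.*2.+1).
  have [e2 e2P] := suspn_homology_coordinate i.*2.+1 eP.
  exact: homology_isomorphic e2P.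
by move=> j j0 ji; apply/exact_homology/exM.
Qed.

End TowerHomology.

(** * Direct limits of eventually constant sequences *)

Section SplitSequence.
Variable R : pzRingType.

(* The composite of the maps f from X i to X k if i <= k, of the maps p if
   k <= i.  Shifting the sequence in the recursive call avoids any cast between
   terms with provably equal indices. *)
Fixpoint transition (X : nat -> lmodType R)
    (f : forall i, {linear X i -> X i.+1})
    (p : forall i, {linear X i.+1 -> X i}) (i k : nat) {struct i} : {linear X i -> X k} :=
  match i, k return {linear X i -> X k} with
  | 0, _ => nat_rect (fun k => {linear X 0%N -> X k}) idfun
      (fun k g => f k \o g) k
  | l.+1, 0 => nat_rect (fun l => {linear X l -> X 0%N}) idfun
      (fun l g => g \o p l) l.+1
  | l.+1, m.+1 => @transition (fun i => X i.+1) (fun i => f i.+1)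
      (fun i => p i.+1) l m
  end.

Implicit Types X : nat -> lmodType R.

Lemma transition_id X (f : forall i, {linear X i -> X i.+1})
    (p : forall i, {linear X i.+1 -> X i}) i u : @transition X f p i i u = u.
Proof. by elim: i X f p u => [//|i IHi] X f p u; exact: IHi. Qed.

(** For [k <= i] the extra factor [f i] is undone by [p i]; for [i < k] it is the first factor of
    the upward composite. *)
Lemma transition_compat X (f : forall i, {linear X i -> X i.+1})
    (p : forall i, {linear X i.+1 -> X i}) : (forall i, cancel (f i) (p i)) ->
  forall i k u, @transition X f p i.+1 k (f i u) = transition f p i k u.
Proof.
move=> fK i k; elim: i k X f p fK => [|i IHi] [|k] X f p fK u /=.
- by rewrite fK.
- by elim: k => [|k /= ->].
- by rewrite fK.
- exact: (IHi k _ _ _ (fun i => fK i.+1)).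
Qed.

End SplitSequence.

Section StableLimit.
Variables (R : pzRingType) (X : nat -> complex R).
Variable f : forall i, chain_map (X i) (X i.+1).

(** Claims on [X i j] are checked at [i = j], descend along [f], and ascend where [f] is onto in
    degree [j]. *)
Lemma nat_updown (Q : nat -> Prop) j : Q j -> (forall i, Q i.+1 -> Q i) ->
  (forall i, (j <= i)%N -> Q i -> Q i.+1) -> forall i, Q i.
Proof.
move=> Qj down up i; have [ij|ji] := leqP i j.
  have: Q (i + (j - i))%N by rewrite subnKC.
  by elim: (j - i)%N => [|d IHd]; rewrite ?addn0 // addnS => /down.
rewrite -(subnKC (ltnW ji)); elim: (i - j)%N => [|d IHd]; rewrite ?addn0 //.
by rewrite addnS; apply: up => //; rewrite leq_addr.
Qed.

(** The bound [j <= i] is cruder than the tower allows, but avoids doubling. *)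
Definition stable_cocone (L : complex R) (h : forall i, chain_map (X i) L) :=
  cocone f h /\ forall i j, (j <= i)%N -> bijective (h i j).

Hypothesis f_surj : forall i j, (j <= i)%N ->
  forall u : X i.+1 j, exists v, f i j v = u.

Lemma stable_cocone_limit L (h : forall i, chain_map (X i) L) :
  stable_cocone h -> is_direct_limit f h.
Proof.
move=> [hf h_bij]; split=> // L' h' hf'.
have inv j : {k : {linear L j -> X j j} |
    cancel (h j j) k /\ cancel k (h j j)}.
  apply: cid; have [k hK kK] := linear_inverse (h_bij j j (leqnn j)).
  by exists k.
pose k j := sval (inv j).
have kP j : cancel (h j j) (k j) /\ cancel (k j) (h j j) := proj2_sig (inv j).
pose g j : {linear L j -> L' j} := h' j j \o k j.
have gh i j u : g j (h i j u) = h' i j u.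
  move: i u; apply: (@nat_updown _ j) => [u|i Qi u|i ji Qi u].
  - by rewrite /= (kP j).1.
  - by rewrite -hf Qi hf'.
  - by have [v <-] := f_surj ji u; rewrite hf Qi hf'.
have gP j (u : L j.+1) : g j (diff L j u) = diff L' j (g j.+1 u).
  by rewrite -[u](kP j.+1).2 -cmapP !gh cmapP.
split; first by exists (ChainMap gP).
move=> g1 g2 g1P g2P j u.
by rewrite -[u](kP j).2 g1P g2P.
Qed.

(** Direct limits are unique up to isomorphism, so one stable model makes every direct limit
    stable. *)
Lemma direct_limit_stable L0 (h0 : forall i, chain_map (X i) L0) L
    (h : forall i, chain_map (X i) L) :
  stable_cocone h0 -> is_direct_limit f h -> stable_cocone h.
Proof.
move=> [h0f h0_bij] [hf univ]; split=> // i j ji.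
have [[g gP] _] := univ _ _ h0f.
have [_ /(_ _ _ hf)[[g' g'P] _]] := stable_cocone_limit (conj h0f h0_bij).
have [_ uniq] := univ _ _ hf.
have g'gK u : g' j (g j u) = u.
  have gg'P j' (v : L j'.+1) : (g' j' \o g j') (diff L j' v) =
      diff L j' ((g' j'.+1 \o g j'.+1) v) by rewrite /= !cmapP.
  have idP j' (v : L j'.+1) : idfun (diff L j' v) = diff L j' (idfun v) by [].
  apply: (uniq (ChainMap (cmap := fun j' => g' j' \o g j') gg'P)
               (ChainMap (cmap := fun j' => idfun) idP)) => // i' j' v.
  by rewrite /= gP g'P.
have [k hK kK] := h0_bij i j ji.
exists (k \o g j) => u /=; first by rewrite gP hK.
by rewrite -g'P kK g'gK.
Qed.

Variable p : forall i j, {linear X i.+1 j -> X i j}.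
Hypothesis fK : forall i j, cancel (f i j) (p i j).

Lemma stable_cocone_exists :
  exists L (h : forall i, chain_map (X i) L), stable_cocone h.
Proof.
pose t j i k : {linear X i j -> X k j} :=
  @transition R (fun i => X i j) (fun i => f i j) (fun i => p i j) i k.
have tf j i k u : t j i.+1 k (f i j u) = t j i k u.
  exact: (@transition_compat R (fun i => X i j) (fun i => f i j)
    (fun i => p i j) (fun i => @fK i j)).
have tid j u : t j j j u = u
  by exact: (@transition_id R (fun i => X i j)).
(* The limit has [X j j] in degree [j]; the boundary, computed in stage [j.+1], is brought back to
   stage [j]. *)
pose d j : {linear X j.+1 j.+1 -> X j j} := t j j.+1 j \o diff (X j.+1) j.
have tP i j (u : X i j.+1) :
    t j i j (diff (X i) j u) = d j (t j.+1 i j.+1 u).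
  (* The maps [p] are linear only degreewise, so compatibility with differentials is checked through
     [f]. *)
  move: i u; apply: (@nat_updown _ j.+1) => [u|i Qi u|i ji Qi u].
  - by rewrite tid.
  - by rewrite -(tf j) -(tf j.+1) cmapP Qi.
  - by have [v <-] := f_surj ji u; rewrite -cmapP !tf Qi.
have dK j u : d j (d j.+1 u) = 0.
  by rewrite -[u]tid -!tP diffK linear0.
pose L := @Complex R (fun j => X j j) d dK.
pose h i : chain_map (X i) L := @ChainMap R (X i) L (fun j => t j i j) (tP i).
exists L, h; split=> [i j u|i j ji]; first exact: tf.
rewrite -(subnKC ji); elim: (i - j)%N => [|m IHm].
  by rewrite addn0; exists idfun => u; exact: tid.
rewrite addnS.
have f_bij : bijective (f (j + m)%N j).
  apply: inj_surj_bijective; first exact: can_inj (@fK _ _).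
  exact/f_surj/leq_addr.
have [g fgK gfK] := f_bij.
apply: (eq_bij (bij_comp IHm (Bijective gfK fgK))) => u.
by rewrite /= -[in RHS](gfK u) [RHS]tf.
Qed.

End StableLimit.

(** * The limit of the tower as a resolution *)

Section TowerLimit.
Variables (R : pzRingType) (C : complex R) (f : chain_map (susp C) C).
Variable c : choices C.

Lemma tower_eta_surj i j : (j <= i)%N ->
  forall u : M f c i.+1 j, exists v, etaM f c i j v = u.
Proof.
move=> ji u; have [|g _ gK] := @tower_eta_bijective _ _ f c i j.
  by rewrite doubleS !ltnS (leq_trans ji) // -addnn -addnS leq_addr.
by exists (g u).
Qed.

Lemma tower_limit_exists :
  exists L (h : forall i, chain_map (M f c i) L), stable_cocone (etaM f c) h.
Proof.
exact: (stable_cocone_exists tower_eta_surj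
  (p := fun i j => snd : {linear M f c i.+1 j -> M f c i j})).
Qed.

Variable N : lmodType R.
Hypothesis tow : forall i, tower_homology f c N i.
Hypotheses (projC : forall m, projective (C m)) (fgC : forall m, fin_gen (C m)).

Lemma tower_limit_resolution L (h : forall i, chain_map (M f c i) L) :
  stable_cocone (etaM f c) h ->
  exists e' : {linear L 0%N -> N}, fin_type_proj_resolution e'.
Proof.
move=> [_ h_bij].
(* Stage 1 already agrees with the limit in degrees 0 and 1. *)
have [_ _ _ [e1 [e1_surj e1_ker]]] := tow 1.
have [k0 hk0 kh0] := linear_inverse (h_bij 1%N 0%N isT).
have L_iso j : isomorphic (M f c j j) (L j) by exists (h j j); exact: h_bij.
exists (e1 \o k0); split; last first.
  move=> j; have [hj [k _ kK]] := L_iso j.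
  apply: (fin_gen_surj (f := hj)); first by move=> u; exists (k u).
  exact: tower_fin_gen.
split; last first.
  by move=> j; apply: (projective_iso (L_iso j)); exact: tower_projective.
split=> [y|u|j u].
- by have [u _ <-] := e1_surj y; exists (h 1%N 0%N u); rewrite /= hk0.
- rewrite /= e1_ker //; split=> [[v vE]|[v ->]].
    by exists (h 1%N 1%N v); rewrite -cmapP -vE kh0.
  have [k1 _ kh1] := h_bij 1%N 1%N isT.
  by exists (k1 v); rewrite -{1}(kh1 v) -cmapP hk0.
split=> [du|[v ->]]; last exact: diffK.
(* Stage [j.+2] agrees with [L] up to degree [j.+2], and its upper copy of [N] sits in degree 2j+5,
   beyond [j.+1]. *)
have [_ _ exM _] := tow j.+2.
have le2 m : (m <= j.+2)%N -> bijective (h j.+2 m) by apply: h_bij.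
have [k1 _ hk1] := le2 j.+1 (leqnSn _).
have [k2 hk2 _] := le2 j (leqW (leqnSn _)).
have /exM[||v vE] : is_cycle (k1 u).
- by apply: (can_inj hk2); rewrite linear0 cmapP hk1.
- by [].
- apply/eqP; rewrite ltn_eqF // ltnS -addnn.
  by rewrite (leq_trans (leqnSn _)) ?leq_addr.
by exists (h _ _ v); rewrite -cmapP -vE hk1.
Qed.

End TowerLimit.

Theorem mainTheorem3
  (R : pzRingType) (hR : finite_left_gldim R)
  (x : R) (xC : central x) (x_neq1 : x <> 1) (x_reg : GRing.lreg x)
  (N : lmodType (quoring xC)) (hN : FP_infty N)
  (P : complex R) (aug : {linear P 0%N -> restr N}) (n : nat)
  (hP : fin_type_proj_resolution aug) (hPn : length_le P n)
  (hn : pd_eq (restr N) n)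
  (phi : forall j, {linear P j -> P j.+1}) (hphi : null_homotopy x phi)
  (c : choices (red_complex xC P)) :
  let f := Psi xC hphi in
  (forall i, (forall k, (k < i)%N -> is_lift (psi f c k.+1)) ->
    exists g : chain_map (suspn i.*2.+3 (red_complex xC P)) (M f c i.+1),
      is_lift g) /\
  ((forall i, is_lift (psi f c i.+1)) ->
    [/\ (* (1) *)
        forall k, [/\ forall j, projective (M f c k.+1 j) /\ fin_gen (M f c k.+1 j),
                      explicit_terms f c n k & explicit_diffs f c n k],
        (* (2) *)
        forall i, (0 < i)%N ->
          [/\ isomorphic (homology (M f c i) 0) N,
              isomorphic (homology (M f c i) i.*2.+1) N &
              forall j, j <> 0%N -> j <> i.*2.+1 ->
                is_zero (homology (M f c i) j)],
        (* (3) *)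
        forall i, (0 < i)%N -> bijective (homology_map (psi f c i) i.*2.+1) &
        (* (4) *)
        (exists L (h : forall i, chain_map (M f c i) L),
          is_direct_limit (etaM f c) h) /\
        (forall L (h : forall i, chain_map (M f c i) L),
          is_direct_limit (etaM f c) h ->
          exists e : {linear L 0%N -> N}, fin_type_proj_resolution e)]).
Proof.
move=> f; have [[_ projP] fgP] := hP.
have projC m : projective (red_complex xC P m) by exact/red_projective/projP.
have fgC m : fin_gen (red_complex xC P m) by exact/red_fin_gen/fgP.
have Cn : length_le (red_complex xC P) n.
  move=> j nj q; rewrite -(to_red_repr q) (hPn j nj (repr _)).
  exact: to_red0.
have [e eP] := red_augmentation hP.
(* Only the lifts below [i] are assumed, so that the existence of the next lift follows as well. *)
have tower i : (forall k, (k < i)%N -> is_lift (psi f c k.+1)) ->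
    tower_homology f c N i.
  have f_inj : homology_inj f 1
    by exact: (@Psi_homology_inj _ _ _ x_reg _ _ _ hP _ hphi).
  have f_surj : homology_surj f 1
    by exact: (@Psi_homology_surj _ _ _ _ _ _ hP _ hphi).
  exact: (tower_homologyP eP (red_exact x_reg hP) f_inj f_surj).
split=> [i /tower|lift]; first exact: tower_lift_exists.
have tow i : tower_homology f c N i by apply: tower.
have isos i := tower_homology_isos eP (tow i).
split.
- move=> k; split; last exact: tower_explicit_diffs.
    by move=> j; split; [exact: tower_projective | exact: tower_fin_gen].
  exact: tower_explicit_terms.
- by move=> i _; have [] := isos i.
- by move=> i _; have [] := isos i.
have [L0 [h0 h0P]] := tower_limit_exists f c.
split=> [|L h hL].
  exists L0, h0.
  exact: stable_cocone_limit (@tower_eta_surj _ _ f c) _ _ h0P.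
apply: (tower_limit_resolution tow projC fgC (h := h)).
exact: (direct_limit_stable (@tower_eta_surj _ _ f c) h0P).
Qed.
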